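(* An intuitionistic neighbourhood model $\mathcal{M}$ is isomorphic to an intuitionistic neighbourhood model of the form $\mathfrak{M}^{\bullet}$, for some $\mathsf{IFOM}$-structure $\mathfrak{M}$, if and only if $\mathcal{M}$ is coherent and Cartesian.
   Context: Intuitionistic neighbourhood models: for a poset $(W,\le)$, an intuitionistic neighbourhood is a partial function $a:W\rightharpoonup\mathcal{P}(W)$ whose domain $\mathrm{dom}(a)$ is an upset. A model is $\mathcal{M}=(W,\le,N,V)$ with $N$ a set of intuitionistic neighbourhoods and $V$ mapping each proposition letter $p_i$ to an upset. Coherence: $a$ is coherent if (N1) whenever $w\le w'$ with $w\in\mathrm{dom}(a)$ and $v\in a(w)$, there is $v'\in a(w')$ with $v\le v'$; and (N2) whenever $v\in a(w)$ and $v\le v'$, there is $w'\ge w$ with $v'\in a(w')$. $\mathcal{M}$ is coherent if all its neighbourhoods are. Cartesian: define $wRv$ iff $v\in a(w)$ for some $a\in N$ (with $w\in\mathrm{dom}(a)$); let $R^{\sim}$ be the equivalence closure of $R$ and $\le^{\sim}$ the equivalence closure of $\le$. $\mathcal{M}$ is $R^{\sim}$-Cartesian if $w\le^{\sim}v\,R^{\sim}\,w$ implies $w=v$; N-Cartesian if $wR^{\sim}v$ and $w,v\in\mathrm{dom}(a)$ imply $a(w)=a(v)$ for all $a\in N$; Cartesian if both. Isomorphism between $\mathcal{M}=(W,\le,N,V)$ and $\mathcal{M}'=(W',\le',N',V')$: a pair of bijections $\alpha:W\to W'$, $\nu:N\to N'$ such that for all $w,v\in W$, $a\in N$, $u\in\mathrm{dom}(a)$: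 $w\le v$ iff $\alpha(w)\le'\alpha(v)$; $w\in\mathrm{dom}(a)$ iff $\alpha(w)\in\mathrm{dom}(\nu(a))$; $w\in a(u)$ iff $\alpha(w)\in\nu(a)(\alpha(u))$; $w\in V(p_i)$ iff $\alpha(w)\in V'(p_i)$. $\mathsf{IFOM}$-structures: $\mathfrak{M}=(W,\le,\mathcal{I})$ with $(W,\le)$ a poset and, for each $w$, sets $\mathcal{I}(\mathsf{s},w),\mathcal{I}(\mathsf{n},w)$, relations $\mathcal{I}(\mathsf{N},w)\subseteq\mathcal{I}(\mathsf{s},w)\times\mathcal{I}(\mathsf{n},w)$, $\mathcal{I}(\mathsf{E},w)\subseteq\mathcal{I}(\mathsf{n},w)\times\mathcal{I}(\mathsf{s},w)$, $\mathcal{I}(P_i,w)\subseteq\mathcal{I}(\mathsf{s},w)$, with $w\le w'$ implying $\mathcal{I}(X,w)\subseteq\mathcal{I}(X,w')$ for all these $X$. The model $\mathfrak{M}^{\bullet}=(W^{\bullet},\leqq,N^{\bullet},V^{\bullet})$: $W^{\bullet}=\{\langle w,x\rangle\mid w\in W, x\in\mathcal{I}(\mathsf{s},w)\}$; $\langle w,x\rangle\leqq\langle w',x'\rangle$ iff $w\le w'$ and $x=x'$; for each $a\in\bigcup_w\mathcal{I}(\mathsf{n},w)$, $a^{\bullet}(\langle w,x\rangle)=\{\langle w,y\rangle\in W^{\bullet}\mid (a,y)\in\mathcal{I}(\mathsf{E},w)\}$ if $a\in\mathcal{I}(\mathsf{n},w)$ and $(x,a)\in\mathcal{I}(\mathsf{N},w)$,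 undefined otherwise; $N^{\bullet}=\{a^{\bullet}\mid a\in\mathcal{I}(\mathsf{n},w)\text{ for some }w\}$; $V^{\bullet}(p_i)=\{\langle w,x\rangle\in W^{\bullet}\mid x\in\mathcal{I}(P_i,w)\}$. *)

(* Defs.v *)
From Stdlib Require Import Relations Ensembles FinFun ClassicalEpsilon.

Set Implicit Arguments.
Unset Strict Implicit.

(* [f w = None] means that [f] is undefined at [w]. *)
Definition pfun (W : Type) : Type := W -> option (Ensemble W).

Definition dom (W : Type) (f : pfun W) : Ensemble W :=
  fun w => exists A, f w = Some A.

(* [val_at f w v]: [f] is defined at [w] and [v] belongs to [f w]. *)
Definition val_at (W : Type) (f : pfun W) (w v : W) : Prop :=
  exists A, f w = Some A /\ A v.

Definition upset (W : Type) (le : relation W) (A : Ensemble W) : Prop :=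
  forall w v, A w -> le w v -> A v.

(* The type [I] indexes the proposition letters. *)
Record model (I : Type) : Type := Model {
  world : Type;
  le : relation world;
  le_order : order world le;
  nbhd : Ensemble (pfun world);
  nbhd_upset : forall a, nbhd a -> upset le (dom a);
  valuation : I -> Ensemble world;
  valuation_upset : forall i, upset le (valuation i)
}.

Section ModelProperties.
Variables (I : Type) (M : model I).
Implicit Types (a : pfun (world M)) (w v : world M).

Definition N1 a : Prop :=
  forall w w' v, le w w' -> dom a w -> val_at a w v ->
    exists v', val_at a w' v' /\ le v v'.

Definition N2 a : Prop :=
  forall w v v', val_at a w v -> le v v' ->
    exists w', le w w' /\ val_at a w' v'.

Definition coherent : Prop := forall a, nbhd a -> N1 a /\ N2 a.

Definition R : relation (world M) :=
  fun w v => exists a, nbhd a /\ val_at a w v.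

Definition R_eqv : relation (world M) := clos_refl_sym_trans (world M) R.

Definition le_eqv : relation (world M) :=
  clos_refl_sym_trans (world M) (@le I M).

Definition R_cartesian : Prop :=
  forall w v, le_eqv w v -> R_eqv v w -> w = v.

Definition N_cartesian : Prop :=
  forall a, nbhd a -> forall w v,
    R_eqv w v -> dom a w -> dom a v -> a w = a v.

Definition cartesian : Prop := R_cartesian /\ N_cartesian.

End ModelProperties.

Record isomorphism (I : Type) (M M' : model I)
    (alpha : world M -> world M')
    (nu : {a : pfun (world M) | nbhd a} -> {a : pfun (world M') | nbhd a}) : Prop := {
  iso_alpha_bij : Bijective alpha;
  iso_nu_bij : Bijective nu;
  iso_le : forall w v, le w v <-> le (alpha w) (alpha v);
  iso_dom : forall a w,
    dom (proj1_sig a) w <-> dom (proj1_sig (nu a)) (alpha w);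
  iso_val : forall a u w, dom (proj1_sig a) u ->
    (val_at (proj1_sig a) u w <->
     val_at (proj1_sig (nu a)) (alpha u) (alpha w));
  iso_valuation : forall i w, valuation i w <-> valuation i (alpha w)
}.

Definition isomorphic (I : Type) (M M' : model I) : Prop :=
  exists alpha nu, @isomorphism I M M' alpha nu.

(* The sets interpreting the sorts s and n at the various worlds are subsets
   of ambient types [dom_s] and [dom_n], so that inclusions between them make
   sense.  They may be empty, and so may [iworld]. *)
Record ifom (I : Type) : Type := Ifom {
  iworld : Type;
  ile : relation iworld;
  ile_order : order iworld ile;
  dom_s : Type;
  dom_n : Type;
  int_s : iworld -> Ensemble dom_s;
  int_n : iworld -> Ensemble dom_n;
  int_N : iworld -> dom_s -> dom_n -> Prop;
  int_E : iworld -> dom_n -> dom_s -> Prop;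
  int_P : I -> iworld -> Ensemble dom_s;
  int_N_sub : forall w x a, int_N w x a -> int_s w x /\ int_n w a;
  int_E_sub : forall w a x, int_E w a x -> int_n w a /\ int_s w x;
  int_P_sub : forall i w x, int_P i w x -> int_s w x;
  int_s_mono : forall w w', ile w w' -> forall x, int_s w x -> int_s w' x;
  int_n_mono : forall w w', ile w w' -> forall a, int_n w a -> int_n w' a;
  int_N_mono : forall w w', ile w w' ->
    forall x a, int_N w x a -> int_N w' x a;
  int_E_mono : forall w w', ile w w' ->
    forall a x, int_E w a x -> int_E w' a x;
  int_P_mono : forall i w w', ile w w' ->
    forall x, int_P i w x -> int_P i w' x
}.

Section Bullet.
Variables (I : Type) (K : ifom I).

Definition bworld : Type :=
  {p : iworld K * dom_s K | int_s (fst p) (snd p)}.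

Definition bfst (p : bworld) : iworld K := fst (proj1_sig p).
Definition bsnd (p : bworld) : dom_s K := snd (proj1_sig p).

Definition ble : relation bworld :=
  fun p q => ile (bfst p) (bfst q) /\ bsnd p = bsnd q.

Definition bnbhd (a : dom_n K) : pfun bworld :=
  fun p =>
    if excluded_middle_informative
         (int_n (bfst p) a /\ int_N (bfst p) (bsnd p) a)
    then Some (fun q => bfst q = bfst p /\ int_E (bfst p) a (bsnd q))
    else None.

Definition bN : Ensemble (pfun bworld) :=
  fun f => exists a, (exists w : iworld K, int_n w a) /\ f = bnbhd a.

Definition bV (i : I) : Ensemble bworld := fun p => int_P i (bfst p) (bsnd p).

Lemma ble_order : order bworld ble.
Proof.
destruct (ile_order K) as [Hr Ht Ha]; split.
- intros p; split; [apply Hr | reflexivity].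
- intros p q r [H1 E1] [H2 E2]; split.
  + exact (Ht _ _ _ H1 H2).
  + congruence.
- intros [[w x] Hp] [[v y] Hq] [H1 E1] [H2 E2].
  unfold bfst, bsnd in *; simpl in *; subst y.
  assert (E : w = v) by (apply Ha; assumption); subst v.
  f_equal; apply proof_irrelevance.
Qed.

Lemma dom_bnbhd a p :
  dom (bnbhd a) p <-> int_n (bfst p) a /\ int_N (bfst p) (bsnd p) a.
Proof.
unfold dom, bnbhd.
destruct (excluded_middle_informative _) as [H | H]; split.
- intros _; exact H.
- intros _; eexists; reflexivity.
- intros [A E]; discriminate E.
- intros H0; contradiction.
Qed.

Lemma bN_upset f : bN f -> upset ble (dom f).
Proof.
intros [a [_ ->]] p q Hp [Hle E].
apply dom_bnbhd in Hp; destruct Hp as [Hn HN].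
apply dom_bnbhd; rewrite <- E; split.
- exact (int_n_mono Hle Hn).
- exact (int_N_mono Hle HN).
Qed.

Lemma bV_upset i : upset ble (bV i).
Proof.
intros p q Hp [Hle E]; unfold bV; rewrite <- E.
exact (int_P_mono Hle Hp).
Qed.

Definition bullet : model I :=
  {| world := bworld;
     le := ble;
     le_order := ble_order;
     nbhd := bN;
     nbhd_upset := bN_upset;
     valuation := bV;
     valuation_upset := bV_upset |}.

End Bullet.

(* Main.v *)
(** A world [<C, s>] of [bullet K] remembers its first coordinate along [R] and
its second coordinate along the order, so [bullet K] is Cartesian, and coherence
comes from monotonicity of the interpretations.  Conversely, given a coherent
Cartesian model, take the [R]-equivalence classes as worlds and the
[le]-equivalence classes as elements of sort s: by Cartesianness a point is
determined by its pair of classes.  Coherence lifts the order along [R_eqv], and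
this lifting makes the interpretations monotone. *)

From Stdlib Require Import Relations Ensembles FinFun ClassicalEpsilon
  FunctionalExtensionality PropExtensionality.
Require Import Defs.

Set Implicit Arguments.
Unset Strict Implicit.

(** * Equivalence closures, bijections and extensionality *)

Lemma ensemble_ext (W : Type) (A B : Ensemble W) :
  (forall w, A w <-> B w) -> A = B.
Proof.
intros H; apply functional_extensionality; intros w.
apply propositional_extensionality; apply H.
Qed.

(** Equivalence classes are encoded as the predicates [clos_refl_sym_trans W S w], so that
    equivalent points have equal classes. *)
Lemma clos_rst_eq_class (W : Type) (S : relation W) w v :
  clos_refl_sym_trans W S w = clos_refl_sym_trans W S v <->
  clos_refl_sym_trans W S w v.
Proof.
split.
- intros E; rewrite E; apply rst_refl.
- intros H; apply ensemble_ext; intros u; split; intros Hu.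
  + exact (rst_trans _ _ _ _ _ (rst_sym _ _ _ _ H) Hu).
  + exact (rst_trans _ _ _ _ _ H Hu).
Qed.

Lemma clos_rst_map (W W' : Type) (S : relation W) (S' : relation W')
    (f : W -> W') :
  (forall w v, S w v -> S' (f w) (f v)) ->
  forall w v, clos_refl_sym_trans W S w v ->
    clos_refl_sym_trans W' S' (f w) (f v).
Proof.
intros H w v C; induction C; eauto using clos_refl_sym_trans.
Qed.

Lemma clos_rst_invariant (W T : Type) (S : relation W) (f : W -> T) :
  (forall w v, S w v -> f w = f v) ->
  forall w v, clos_refl_sym_trans W S w v -> f w = f v.
Proof.
intros H w v C; induction C; [apply H | | | ]; congruence.
Qed.

(** [Bijective] asks for an inverse function; choice extracts one from surjectivity. *)
Lemma bijective_of_inj_surj (A B : Type) (f : A -> B) :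
  Injective f -> Surjective f -> Bijective f.
Proof.
intros Hi Hs.
exists (fun b => proj1_sig (constructive_indefinite_description _ (Hs b))).
assert (E : forall b,
  f (proj1_sig (constructive_indefinite_description _ (Hs b))) = b).
{ intros b; exact (proj2_sig (constructive_indefinite_description _ (Hs b))). }
split; [intros a; apply Hi | intros b]; apply E.
Qed.

Lemma bijective_surjective (A B : Type) (f : A -> B) :
  Bijective f -> Surjective f.
Proof. intros [g [_ H]] b; exists (g b); apply H. Qed.

Lemma sig_ext (A : Type) (P : A -> Prop) (x y : sig P) :
  proj1_sig x = proj1_sig y -> x = y.
Proof.
destruct x as [x Hx], y as [y Hy]; simpl; intros <-.
f_equal; apply proof_irrelevance.
Qed.

Lemma val_at_dom (W : Type) (f : pfun W) w v : val_at f w v -> dom f w.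
Proof. intros [A [E _]]; exists A; exact E. Qed.

Lemma pfun_value_ext (W : Type) (f g : pfun W) w v :
  (dom f w <-> dom g v) -> (forall u, val_at f w u <-> val_at g v u) ->
  f w = g v.
Proof.
unfold dom, val_at; intros Hd Hv.
destruct (f w) as [A|] eqn:Ef, (g v) as [B|] eqn:Eg.
- f_equal; apply ensemble_ext; intros u; split; intros Hu.
  + destruct (proj1 (Hv u)) as [C [E HC]]; [now exists A | congruence].
  + destruct (proj2 (Hv u)) as [C [E HC]]; [now exists B | congruence].
- destruct (proj1 Hd) as [C E]; [now exists A | discriminate].
- destruct (proj2 Hd) as [C E]; [now exists B | discriminate].
- reflexivity.
Qed.

(** * Coherence and Cartesianness pull back along isomorphisms *)

Section Transfer.
Variables (I : Type) (M M' : model I).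
Variables (alpha : world M -> world M')
  (nu : {a : pfun (world M) | nbhd a} -> {a : pfun (world M') | nbhd a}).
Hypothesis iso : isomorphism alpha nu.

(** [iso_val] is stated for [u] in the domain; either side supplies this, the right one through
    [iso_dom]. *)
Lemma iso_val_at a u w :
  val_at (proj1_sig a) u w <-> val_at (proj1_sig (nu a)) (alpha u) (alpha w).
Proof.
split; intros H.
- apply (iso_val iso); [exact (val_at_dom H) | exact H].
- apply (iso_val iso); [apply (iso_dom iso); exact (val_at_dom H) | exact H].
Qed.

Lemma iso_R_eqv w v : R_eqv w v -> R_eqv (alpha w) (alpha v).
Proof.
apply clos_rst_map; intros x y [a [Ha Hv]].
exists (proj1_sig (nu (exist _ a Ha))); split; [apply proj2_sig |].
apply (iso_val_at (exist _ a Ha)); exact Hv.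
Qed.

Lemma iso_le_eqv w v : le_eqv w v -> le_eqv (alpha w) (alpha v).
Proof. apply clos_rst_map; intros x y; apply (iso_le iso). Qed.

Lemma iso_coherent : coherent M' -> coherent M.
Proof.
intros Hc a Ha; set (a0 := exist _ a Ha : {a | nbhd a}).
assert (Hs := bijective_surjective (iso_alpha_bij iso)).
destruct (Hc _ (proj2_sig (nu a0))) as [H1 H2].
split.
- intros w w' v Hle _ Hv.
  apply (iso_le iso) in Hle; apply (iso_val_at a0) in Hv.
  destruct (H1 _ _ _ Hle (val_at_dom Hv) Hv) as [u [Hu Hvu]].
  destruct (Hs u) as [v' <-]; exists v'; split.
  + apply (iso_val_at a0); exact Hu.
  + apply (iso_le iso); exact Hvu.
- intros w v v' Hv Hle.
  apply (iso_le iso) in Hle; apply (iso_val_at a0) in Hv.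
  destruct (H2 _ _ _ Hv Hle) as [u [Hwu Hu]].
  destruct (Hs u) as [w' <-]; exists w'; split.
  + apply (iso_le iso); exact Hwu.
  + apply (iso_val_at a0); exact Hu.
Qed.

Lemma iso_cartesian : cartesian M' -> cartesian M.
Proof.
intros [HR HN]; split.
- intros w v Hle Hr.
  destruct (iso_alpha_bij iso) as [g [Hg _]].
  rewrite <- (Hg w), <- (Hg v); f_equal.
  apply HR; [apply iso_le_eqv | apply iso_R_eqv]; assumption.
- intros a Ha w v Hr Hw Hv; set (a0 := exist _ a Ha : {a | nbhd a}).
  (* The equality of values holds in [M'] and is pulled back member by member. *)
  assert (E : proj1_sig (nu a0) (alpha w) = proj1_sig (nu a0) (alpha v)).
  { apply HN; [apply proj2_sig | now apply iso_R_eqv | |];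
      apply (iso_dom iso a0); assumption. }
  apply pfun_value_ext; [tauto |].
  intros u; change a with (proj1_sig a0).
  rewrite (iso_val_at a0 w u), (iso_val_at a0 v u).
  unfold val_at; rewrite E; tauto.
Qed.

End Transfer.

(** * Bullet models are coherent and Cartesian *)

Section BulletProperties.
Variables (I : Type) (K : ifom I).

Lemma val_at_bnbhd (a : dom_n K) p q :
  val_at (bnbhd a) p q <->
  int_N (bfst p) (bsnd p) a /\ bfst q = bfst p /\ int_E (bfst p) a (bsnd q).
Proof.
unfold val_at, bnbhd.
destruct (excluded_middle_informative _) as [[Hn HN] | H]; split.
- intros [A [E HA]]; injection E as <-; tauto.
- intros [_ HE]; eexists; split; [reflexivity | exact HE].
- intros [A [E _]]; discriminate E.
- intros [HN _]; destruct H; split; [apply (int_N_sub HN) | exact HN].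
Qed.

Lemma bullet_coherent : coherent (bullet K).
Proof.
intros f [a [_ ->]]; split.
- intros p p' q [Hle E] _ Hq.
  apply val_at_bnbhd in Hq; destruct Hq as [HN [Eq HE]].
  assert (HE' := int_E_mono Hle HE).
  (* The element of [q], moved up to the world of [p']. *)
  exists (exist _ (bfst p', bsnd q) (proj2 (int_E_sub HE')) : bworld K).
  split; [apply val_at_bnbhd | split].
  + rewrite <- E; split; [exact (int_N_mono Hle HN) | now split].
  + change (ile (bfst q) (bfst p')); now rewrite Eq.
  + reflexivity.
- intros p q q' Hq [Hle E].
  apply val_at_bnbhd in Hq; destruct Hq as [HN [Eq HE]].
  rewrite Eq in Hle; assert (HN' := int_N_mono Hle HN).
  (* The element of [p], moved up to the world of [q']. *)
  exists (exist _ (bfst q', bsnd p) (proj1 (int_N_sub HN')) : bworld K).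
  split; [now split | apply val_at_bnbhd].
  split; [exact HN' | split; [reflexivity |]].
  rewrite <- E; exact (int_E_mono Hle HE).
Qed.

Lemma bullet_R_eqv_bfst (p q : world (bullet K)) :
  R_eqv p q -> bfst p = bfst q.
Proof.
apply (clos_rst_invariant (f := @bfst I K)).
intros x y [f [[a [_ ->]] Hv]].
apply val_at_bnbhd in Hv; symmetry; apply Hv.
Qed.

Lemma bullet_le_eqv_bsnd (p q : world (bullet K)) :
  le_eqv p q -> bsnd p = bsnd q.
Proof.
apply (clos_rst_invariant (f := @bsnd I K)); intros x y [_ E]; exact E.
Qed.

Lemma bullet_cartesian : cartesian (bullet K).
Proof.
split.
- intros p q Hle Hr; apply sig_ext.
  apply bullet_R_eqv_bfst in Hr; apply bullet_le_eqv_bsnd in Hle.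
  unfold bfst, bsnd in *.
  rewrite (surjective_pairing (proj1_sig p)), (surjective_pairing (proj1_sig q)).
  congruence.
- intros f [a [_ ->]] p q Hr Hp Hq.
  apply bullet_R_eqv_bfst in Hr.
  (* Where [bnbhd a] is defined, its value depends only on the first coordinate, which [p] and [q]
     share. *)
  apply pfun_value_ext; [tauto | intros u].
  apply dom_bnbhd in Hp, Hq.
  rewrite !val_at_bnbhd, Hr; rewrite Hr in Hp; tauto.
Qed.

End BulletProperties.

(** * Lifting the order along [R_eqv] *)

Section Lifting.
Variables (I : Type) (M : model I).
Hypothesis coh : coherent M.

(** On a single [R] step, [N1] lifts forwards and [N2] backwards. Both directions are proved
    together because symmetry exchanges them. *)
Lemma R_eqv_lift (w v : world M) :
  R_eqv w v ->
  (forall w', le w w' -> exists v', le v v' /\ R_eqv w' v') /\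
  (forall v', le v v' -> exists w', le w w' /\ R_eqv w' v').
Proof.
intros H; induction H as [w v H | w | w v _ IH | w v u _ IH1 _ IH2].
- destruct H as [a [Ha Hv]]; destruct (coh Ha) as [H1 H2]; split.
  + intros w' Hle.
    destruct (H1 _ _ _ Hle (val_at_dom Hv) Hv) as [v' [Hv' Hle']].
    exists v'; split; [exact Hle' | apply rst_step; now exists a].
  + intros v' Hle; destruct (H2 _ _ _ Hv Hle) as [w' [Hle' Hv']].
    exists w'; split; [exact Hle' | apply rst_step; now exists a].
- split; intros w' Hle; exists w'; split; trivial; apply rst_refl.
- destruct IH as [IH1 IH2]; split; intros x Hx.
  + destruct (IH2 x Hx) as [y [Hy Hr]].
    exists y; split; [exact Hy | apply rst_sym; exact Hr].
  + destruct (IH1 x Hx) as [y [Hy Hr]].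
    exists y; split; [exact Hy | apply rst_sym; exact Hr].
- destruct IH1 as [F1 B1], IH2 as [F2 B2]; split; intros x Hx.
  + destruct (F1 x Hx) as [y [Hy Hxy]]; destruct (F2 y Hy) as [z [Hz Hyz]].
    exists z; split; [exact Hz | exact (rst_trans _ _ _ _ _ Hxy Hyz)].
  + destruct (B2 x Hx) as [y [Hy Hxy]]; destruct (B1 y Hy) as [z [Hz Hyz]].
    exists z; split; [exact Hz | exact (rst_trans _ _ _ _ _ Hyz Hxy)].
Qed.

End Lifting.

(** * Blocks of the [R]-equivalence and their order *)

Section Representation.
Variables (I : Type) (M : model I).
Hypotheses (coh : coherent M) (cart : cartesian M).

(* The empty set is included as a world: a nowhere defined neighbourhood must
   be named at some world of the structure even when [M] has no worlds. *)
Definition is_R_block (C : Ensemble (world M)) : Prop :=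
  forall w, C w -> C = R_eqv w.

Definition R_block : Type := {C : Ensemble (world M) | is_R_block C}.

Lemma R_class_is_R_block (w : world M) : is_R_block (R_eqv w).
Proof. intros v H; apply clos_rst_eq_class; exact H. Qed.

Definition R_class (w : world M) : R_block :=
  exist _ (R_eqv w) (@R_class_is_R_block w).

Lemma R_block_eqv (C : R_block) w v :
  proj1_sig C w -> (proj1_sig C v <-> R_eqv w v).
Proof. intros Hw; rewrite (proj2_sig C w Hw); tauto. Qed.

Lemma R_class_refl w : proj1_sig (R_class w) w.
Proof. apply rst_refl. Qed.

(** Between nonempty blocks, lifting makes this equivalent to having one related pair of points. The
    empty block lies below every block. *)
Definition R_block_le : relation R_block := fun C D =>
  forall w, proj1_sig C w -> exists v, proj1_sig D v /\ le w v.

(** [R_cartesian] in the form used below: a block and a [le]-class meet in at most one point. *)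
Lemma R_block_point_unique (C : R_block) w v :
  proj1_sig C w -> proj1_sig C v -> le_eqv w = le_eqv v -> w = v.
Proof.
intros Hw Hv E; apply (proj1 cart).
- apply clos_rst_eq_class; exact E.
- apply (R_block_eqv w Hv); exact Hw.
Qed.

Lemma le_eqv_class (w v : world M) : le w v -> le_eqv w = le_eqv v.
Proof. intros H; apply clos_rst_eq_class, rst_step; exact H. Qed.

Lemma R_block_le_sub C D :
  R_block_le C D -> R_block_le D C -> forall w, proj1_sig C w -> proj1_sig D w.
Proof.
intros HCD HDC w Hw.
destruct (HCD w Hw) as [v [Hv Hwv]]; destruct (HDC v Hv) as [w' [Hw' Hvw]].
(* Going up to [D] and back to [C] stays in one [le]-class, so it returns to [w]; antisymmetry then
   gives [w = v]. *)
assert (w = w').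
{ apply (R_block_point_unique Hw Hw').
  rewrite (le_eqv_class Hwv); exact (le_eqv_class Hvw). }
subst w'.
now replace w with v by exact (ord_antisym _ _ (le_order M) _ _ Hvw Hwv).
Qed.

Lemma R_block_le_order : order R_block R_block_le.
Proof.
destruct (le_order M) as [Hr Ht _]; split.
- intros C w Hw; exists w; split; [exact Hw | apply Hr].
- intros C D E HCD HDE w Hw.
  destruct (HCD w Hw) as [v [Hv Hwv]]; destruct (HDE v Hv) as [u [Hu Hvu]].
  exists u; split; [exact Hu | exact (Ht _ _ _ Hwv Hvu)].
- intros C D HCD HDC; apply sig_ext, ensemble_ext; intros w.
  split; apply R_block_le_sub; assumption.
Qed.

(** * The representing structure *)

(** When [C] and [s] meet, the pair names their unique common point; [rep_N] and [rep_P] state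
    properties of that point. *)
Definition rep_s (C : R_block) : Ensemble (Ensemble (world M)) :=
  fun s => exists w, proj1_sig C w /\ le_eqv w = s.

Definition rep_N (C : R_block) (s : Ensemble (world M))
    (a : {a : pfun (world M) | nbhd a}) : Prop :=
  exists w, proj1_sig C w /\ le_eqv w = s /\ dom (proj1_sig a) w.

(** The relation does not see the point at which [a] is evaluated, so [w] ranges over the block;
    [N_cartesian] makes the choice immaterial. *)
Definition rep_E (C : R_block) (a : {a : pfun (world M) | nbhd a})
    (s : Ensemble (world M)) : Prop :=
  exists w v, proj1_sig C w /\ le_eqv v = s /\ val_at (proj1_sig a) w v.

Definition rep_P (i : I) (C : R_block) : Ensemble (Ensemble (world M)) :=
  fun s => exists w, proj1_sig C w /\ le_eqv w = s /\ valuation i w.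

Lemma R_block_val_at (C : R_block) (a : {a : pfun (world M) | nbhd a}) w v :
  proj1_sig C w -> val_at (proj1_sig a) w v -> proj1_sig C v.
Proof.
intros Hw Hv; apply (R_block_eqv v Hw), rst_step.
exists (proj1_sig a); split; [apply proj2_sig | exact Hv].
Qed.

(** Every neighbourhood is present at every block, and [rep_N] records where it is defined. The
    definition is transparent so that [iworld rep] reduces to [R_block]. *)
Definition rep : ifom I.
Proof.
refine (@Ifom I R_block R_block_le R_block_le_order
  (Ensemble (world M)) {a : pfun (world M) | nbhd a}
  rep_s (fun _ _ => True) rep_N rep_E rep_P _ _ _ _ _ _ _ _).
- intros C s a [w [Hw [E _]]]; split; [now exists w | trivial].
- intros C a s [w [v [Hw [E Hv]]]]; split; [trivial |].
  exists v; split; [exact (R_block_val_at Hw Hv) | exact E].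
- intros i C s [w [Hw [E _]]]; now exists w.
- intros C D H s [w [Hw <-]]; destruct (H w Hw) as [v [Hv Hle]].
  exists v; split; [exact Hv | symmetry; exact (le_eqv_class Hle)].
- trivial.
- intros C D H s a [w [Hw [<- Ha]]]; destruct (H w Hw) as [v [Hv Hle]].
  exists v; split; [exact Hv | split; [symmetry; exact (le_eqv_class Hle) |]].
  exact (nbhd_upset (proj2_sig a) Ha Hle).
- intros C D H a s [w [v [Hw [<- Hv]]]]; destruct (H w Hw) as [w' [Hw' Hle]].
  (* [N1] carries the value [v] up to a value at [w'] within the same [le]-class. *)
  destruct (proj1 (coh (proj2_sig a)) _ _ _ Hle (val_at_dom Hv) Hv)
    as [v' [Hv' Hle']].
  exists w', v'; split; [exact Hw' | split; [| exact Hv']].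
  symmetry; exact (le_eqv_class Hle').
- intros i C D H s [w [Hw [<- HP]]]; destruct (H w Hw) as [v [Hv Hle]].
  exists v; split; [exact Hv | split; [symmetry; exact (le_eqv_class Hle) |]].
  exact (valuation_upset HP Hle).
Defined.

Lemma rep_s_R_class (w : world M) : rep_s (R_class w) (le_eqv w).
Proof. exists w; split; [apply R_class_refl | reflexivity]. Qed.

(** * The isomorphism onto the bullet of the representing structure *)

Definition rep_world (w : world M) : world (bullet rep) :=
  exist (fun p : iworld rep * dom_s rep => int_s (fst p) (snd p))
    (R_class w, le_eqv w) (rep_s_R_class w).

Lemma rep_nbhd_in (a : {a : pfun (world M) | nbhd a}) :
  nbhd (m := bullet rep) (bnbhd (K := rep) a).
Proof.
exists a; split; [| reflexivity].
(* The empty block serves as the world naming [a]. *)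
assert (H0 : is_R_block (fun _ => False)) by (intros w []).
exists (exist _ _ H0); exact Logic.I.
Qed.

Definition rep_nbhd (a : {a : pfun (world M) | nbhd a}) :
    {f : pfun (world (bullet rep)) | nbhd f} :=
  exist _ (bnbhd (K := rep) a) (rep_nbhd_in a).

Lemma R_class_eq w v : proj1_sig (R_class v) w -> R_class w = R_class v.
Proof.
intros H; apply sig_ext; symmetry; exact (proj2_sig (R_class v) w H).
Qed.

(** Injectivity is uniqueness of the common point of a block and a [le]-class; surjectivity is its
    existence, which [rep_s] demands. *)
Lemma rep_world_bij : Bijective rep_world.
Proof.
apply bijective_of_inj_surj.
- intros w v E.
  assert (E1 : R_class w = R_class v) by exact (f_equal (@bfst I rep) E).
  assert (E2 : le_eqv w = le_eqv v) by exact (f_equal (@bsnd I rep) E).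
  apply (R_block_point_unique (C := R_class v)).
  + rewrite <- E1; apply R_class_refl.
  + apply R_class_refl.
  + exact E2.
- intros [[C s] [w [Hw E]]]; exists w; apply sig_ext; simpl in *.
  f_equal; [apply sig_ext; symmetry; exact (proj2_sig C w Hw) | exact E].
Qed.

(** Lifting gives the forward direction. Conversely, [w] lies below some point of the block of [v]
    in the [le]-class of [v], which must be [v]. *)
Lemma rep_world_le (w v : world M) : le w v <-> le (rep_world w) (rep_world v).
Proof.
split.
- intros H; split; [| exact (le_eqv_class H)].
  intros x Hx; destruct (proj1 (R_eqv_lift coh Hx) v H) as [y [Hy Hr]].
  exists y; split; assumption.
- intros [H E].
  destruct (H w (R_class_refl w)) as [v' [Hv' Hle]].
  replace v with v'; [exact Hle |].
  apply (R_block_point_unique Hv' (R_class_refl v)).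
  rewrite <- (le_eqv_class Hle); exact E.
Qed.

Lemma rep_N_R_class w a :
  rep_N (R_class w) (le_eqv w) a <-> dom (proj1_sig a) w.
Proof.
split.
- intros [v [Hv [E Ha]]].
  now rewrite <- (R_block_point_unique Hv (R_class_refl w) E).
- intros Ha; exists w; split; [apply R_class_refl | now split].
Qed.

Lemma rep_dom (a : {a : pfun (world M) | nbhd a}) w :
  dom (proj1_sig a) w <-> dom (proj1_sig (rep_nbhd a)) (rep_world w).
Proof.
rewrite <- rep_N_R_class.
change (dom (proj1_sig (rep_nbhd a)) (rep_world w)) with
  (dom (bnbhd (K := rep) a) (rep_world w)).
rewrite dom_bnbhd; simpl; tauto.
Qed.

Lemma rep_val_at (a : {a : pfun (world M) | nbhd a}) u w :
  val_at (proj1_sig a) u w <->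
  val_at (proj1_sig (rep_nbhd a)) (rep_world u) (rep_world w).
Proof.
change (val_at (proj1_sig (rep_nbhd a)) (rep_world u) (rep_world w)) with
  (val_at (bnbhd (K := rep) a) (rep_world u) (rep_world w)).
rewrite val_at_bnbhd.
change (val_at (proj1_sig a) u w <-> rep_N (R_class u) (le_eqv u) a /\
  R_class w = R_class u /\ rep_E (R_class u) a (le_eqv w)).
rewrite rep_N_R_class; split.
- intros H; split; [exact (val_at_dom H) | split].
  + apply R_class_eq; exact (R_block_val_at (R_class_refl u) H).
  + exists u, w; split; [apply R_class_refl | now split].
- intros [Hu [E [u' [w' [Hu' [Ew H]]]]]].
  assert (w' = w).
  { apply (R_block_point_unique (R_block_val_at Hu' H)); [| exact Ew].
    rewrite <- E; apply R_class_refl. }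
  subst w'; unfold val_at.
  (* [rep_E] provides the value at some [u'] in the block of [u]; [N_cartesian] moves it to [u]. *)
  rewrite (proj2 cart _ (proj2_sig a) u u' Hu' Hu (val_at_dom H)).
  exact H.
Qed.

(** Injectivity holds because [rep_dom] and [rep_val_at] recover [a] from [bnbhd a]. *)
Lemma rep_nbhd_bij : Bijective rep_nbhd.
Proof.
apply bijective_of_inj_surj.
- intros a b E; apply sig_ext, functional_extensionality; intros w.
  apply pfun_value_ext.
  + rewrite !rep_dom, E; tauto.
  + intros u; rewrite !rep_val_at, E; tauto.
- intros [f Hf]; assert (H := Hf); destruct H as [a [_ E]]; exists a; apply sig_ext.
  symmetry; exact E.
Qed.

Lemma rep_valuation i (w : world M) :
  valuation i w <-> valuation i (rep_world w).
Proof.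
change (valuation i w <-> rep_P i (R_class w) (le_eqv w)); split.
- intros H; exists w; split; [apply R_class_refl | now split].
- intros [v [Hv [E H]]].
  now rewrite <- (R_block_point_unique Hv (R_class_refl w) E).
Qed.

Lemma rep_isomorphism : isomorphism rep_world rep_nbhd.
Proof.
split.
- exact rep_world_bij.
- exact rep_nbhd_bij.
- exact rep_world_le.
- exact rep_dom.
- intros a u w _; apply rep_val_at.
- exact rep_valuation.
Qed.

End Representation.

Theorem theorem3p22 (I : Type) (M : model I) :
  (exists K : ifom I, isomorphic M (bullet K)) <-> (coherent M /\ cartesian M).
Proof.
split.
- intros [K [alpha [nu iso]]]; split.
  + exact (iso_coherent iso (@bullet_coherent I K)).
  + exact (iso_cartesian iso (bullet_cartesian K)).
- intros [coh cart]; exists (rep coh cart).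
  exists (rep_world coh cart), (rep_nbhd coh cart).
  apply rep_isomorphism.
Qed.
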